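(* Let $\mathbb F$ be a field of characteristic $p$, $S=\{R_0,\dots,R_d\}$ a quasi-thin scheme on $X$, $x\in X$, $\mathcal T=\mathcal T(x)$, and let $M_n(\mathbb F)$ denote the full matrix algebra of $n\times n$ matrices over $\mathbb F$. (i) If $S$ is thin, then $\mathcal T\cong M_{|X|}(\mathbb F)$ as $\mathbb F$-algebras. (ii) Suppose $S$ is not thin. Set $\mathcal A_i=\{a: R_a\in S,\ k_a=i\}$ for $i\in\{1,2\}$, and define a binary relation $\sim$ on $\mathcal A_2$ by: $b\sim c$ if and only if $|R_{b'}R_c|=2$ or $(b,c)$ is a bad pair of $S$. Then $\sim$ is an equivalence relation on $\mathcal A_2$. Let $\mathcal C_0,\dots,\mathcal C_\gamma$ be all pairwise distinct equivalence classes of $\sim$. (a) If $p\neq 2$, there exist minimal two-sided ideals $\mathcal I_{-1},\mathcal I_0,\dots,\mathcal I_\gamma$ of $\mathcal T$ such that: (a1) each $\mathcal I_j$, $j\in\{-1,0,\dots,\gamma\}$, is a unital $\mathbb F$-algebra; (a2) $\mathcal I_{-1}$ is a simple $\mathbb F$-algebra of $\mathbb F$-dimension $(d+1)^2$; (a3) as $\mathbb F$-algebras, $\mathcal T=\mathcal I_{-1}\oplus\bigoplus_{k=0}^{\gamma}\mathcal I_k\cong \mathcal I_{-1}\oplus\bigoplus_{k=0}^{\gamma}M_{|\mathcal C_k|}(\mathbb F)$. (b) If $p=2$, let $\mathcal J$ be the Jacobson radical of $\mathcal T$. Then there exist minimal two-sided ideals $\mathcal K_{-1},\mathcal K_0,\dots,\mathcal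 K_\gamma$ of $\mathcal T/\mathcal J$ such that: (b1) each $\mathcal K_u$, $u\in\{-1,0,\dots,\gamma\}$, is a unital $\mathbb F$-algebra; (b2) as $\mathbb F$-algebras, $\mathcal T/\mathcal J=\mathcal K_{-1}\oplus\bigoplus_{v=0}^{\gamma}\mathcal K_v\cong M_{|\mathcal A_1|}(\mathbb F)\oplus\bigoplus_{v=0}^{\gamma}M_{|\mathcal C_v|}(\mathbb F)$.
   Context: Let $X$ be a nonempty finite set. A scheme of class $d$ on $X$ is a partition $S=\{R_0,\dots,R_d\}$ of $X\times X$ into nonempty sets such that $R_0=\{(b,b):b\in X\}$; for each $c$ there is $c'$ with $R_{c'}=\{(f,e):(e,f)\in R_c\}$; and for all $i,j,k$ the intersection number $p_{ij}^k=|\{\ell\in X:(m,\ell)\in R_i,(\ell,n)\in R_j\}|$ does not depend on $(m,n)\in R_k$. The valency of $R_a$ is $k_a=p_{aa'}^0$; $S$ is thin if all $k_a=1$, quasi-thin if all $k_a\le 2$. Complex product: $R_aR_b=\{R_c\in S:p_{ab}^c>0\}$. For $y\in X$, $yR_a=\{z:(y,z)\in R_a\}$. $A_a\in M_X(\mathbb F)$ is the $(0,1)$ adjacency matrix of $R_a$ and $E_a^*(y)$ is the diagonal $(0,1)$-matrix with ones exactly at positions indexed by $yR_a$. The Terwilliger $\mathbb F$-algebra $\mathcal T(y)$ is the $\mathbb F$-subalgebra of $M_X(\mathbb F)$ generated by $A_0,\dots,A_d,E_0^*(y),\dots,E_d^*(y)$. Bad pair: $(u,v)$ is a bad pair of $S$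 if there exist an integer $a\ge1$ and $R_{i_b},R_{j_b},R_{\ell_b}\in S$ ($b=0,\dots,a$) with $i_0=u$, $\ell_a=v$, $k_{i_b}=k_{\ell_b}=2$ and $p_{i_bj_b}^{\ell_b}=1$ for all $b$, $\ell_c=i_{c+1}$ for $0\le c\le a-1$, and $|R_{u'}R_v|=1$. *)

(* Defs.v *)
From HB Require Import structures.
From mathcomp Require Import all_boot all_order all_algebra all_field.

Set Implicit Arguments.
Unset Strict Implicit.
Unset Printing Implicit Defensive.

Import GRing.Theory.
Local Open Scope ring_scope.

(* Association schemes.  The underlying nonempty finite set X is 'I_N.+1,   *)
(* the relations R_0,...,R_d are encoded by the map r : X -> X -> 'I_d.+1,  *)
(* with (y,z) \in R_a  <->  r y z = a.                                      *)
Section Scheme.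
Variable F : fieldType.
Variables (N d : nat).
Variable r : 'I_N.+1 -> 'I_N.+1 -> 'I_d.+1.

Definition pnum (i j : 'I_d.+1) (m n : 'I_N.+1) : nat :=
  #|[set l | (r m l == i) && (r l n == j)]|.

Definition is_scheme : Prop :=
  (forall a : 'I_d.+1, exists y z, r y z = a) /\
  (forall y z, (r y z == ord0) = (y == z)) /\
  (forall c : 'I_d.+1, exists c' : 'I_d.+1,
      forall y z, r y z = c' <-> r z y = c) /\
  (forall (i j k : 'I_d.+1) (m n m' n' : 'I_N.+1),
      r m n = k -> r m' n' = k -> pnum i j m n = pnum i j m' n').

Definition intnum (i j k : 'I_d.+1) : nat :=
  if [pick mn : 'I_N.+1 * 'I_N.+1 | r mn.1 mn.2 == k] is Some mn
  then pnum i j mn.1 mn.2 else 0%N.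

Definition trind (c : 'I_d.+1) : 'I_d.+1 :=
  odflt c [pick c' : 'I_d.+1 |
             [forall y, forall z, (r y z == c') == (r z y == c)]].

Definition valency (a : 'I_d.+1) : nat := intnum a (trind a) ord0.

Definition thin : Prop := forall a, valency a = 1%N.
Definition quasi_thin : Prop := forall a, (valency a <= 2)%N.

Definition cprod (a b : 'I_d.+1) : {set 'I_d.+1} :=
  [set c | (0 < intnum a b c)%N].

Definition bad_pair (u v : 'I_d.+1) : Prop :=
  exists (a : nat) (i j l : nat -> 'I_d.+1),
    [/\ (1 <= a)%N, i 0%N = u /\ l a = v,
        (forall b, (b <= a)%N ->
            [/\ valency (i b) = 2%N, valency (l b) = 2%N &
                intnum (i b) (j b) (l b) = 1%N]),
        (forall c, (c < a)%N -> l c = i c.+1) &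
        #|cprod (trind u) v| = 1%N].

Definition Aset (i : nat) : {set 'I_d.+1} := [set a | valency a == i].

Definition sim (b c : 'I_d.+1) : Prop :=
  #|cprod (trind b) c| = 2%N \/ bad_pair b c.

Definition equiv_on (A : {set 'I_d.+1}) (R : 'I_d.+1 -> 'I_d.+1 -> Prop) :=
  [/\ forall b, b \in A -> R b b,
      forall b c, b \in A -> c \in A -> R b c -> R c b &
      forall b c e, b \in A -> c \in A -> e \in A -> R b c -> R c e -> R b e].

Definition is_classes (A : {set 'I_d.+1}) (R : 'I_d.+1 -> 'I_d.+1 -> Prop)
  (P : {set {set 'I_d.+1}}) : Prop :=
  forall C : {set 'I_d.+1}, C \in P <->
    exists2 b, b \in A & forall c, c \in C <-> (c \in A /\ R b c).

Definition adjm (a : 'I_d.+1) : 'M[F]_N.+1 :=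
  \matrix_(y, z) (r y z == a)%:R.

Definition dualE (x : 'I_N.+1) (a : 'I_d.+1) : 'M[F]_N.+1 :=
  \matrix_(y, z) ((y == z) && (r x y == a))%:R.

Definition Terwilliger (x : 'I_N.+1) : {aspace 'M[F]_N.+1} :=
  (<< \sum_(a < d.+1) (<[adjm a]> + <[dualE x a]>) >>)%AS.

End Scheme.

Section FalgNotions.
Variables (K : fieldType) (aT : falgType K).

Definition ideal_in (U V : {vspace aT}) : bool :=
  [&& (V <= U)%VS, (U * V <= V)%VS & (V * U <= V)%VS].

Definition min_ideal (V : {vspace aT}) : Prop :=
  [/\ ideal_in fullv V, V != 0%VS &
      forall W, ideal_in fullv W -> (W <= V)%VS -> W = 0%VS \/ W = V].

Definition simple_alg (U : {vspace aT}) : Prop :=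
  U != 0%VS /\ forall W, ideal_in U W -> W = 0%VS \/ W = U.

Definition iso_mx (U : {vspace aT}) (m : nat) : Prop :=
  exists f : 'Hom(aT, 'M[K]_m),
    [/\ (f @: U)%VS = fullv, (U :&: lker f)%VS = 0%VS &
        {in U &, forall u v, f (u * v) = f u *m f v}].

Definition left_ideal (L : {vspace aT}) : bool := (fullv * L <= L)%VS.

Definition max_left_ideal (L : {vspace aT}) : Prop :=
  [/\ left_ideal L, L != fullv &
      forall L', left_ideal L' -> (L <= L')%VS -> L' = L \/ L' = fullv].

Definition in_jacobson (t : aT) : Prop :=
  forall L, max_left_ideal L -> t \in L.

End FalgNotions.

(* Main.v *)
(* Fix x and write c(y) = r x y; the fibres of c are the sets xR_a, of size 1  *)
(* or 2, so there is an involution [twin] exchanging the points of each fibre. *)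
(* Each block of an adjacency matrix on xR_a * xR_b is all-ones, zero or, for  *)
(* k_a = k_b = 2, one of the two permutation matrices of size 2; hence r is    *)
(* invariant under applying [twin] to both arguments.  Call a, b of valency 2  *)
(* adjacent when a permutation block occurs, i.e. when |R_{a'}R_b| = 2.  A bad *)
(* pair is exactly a connected nonadjacent pair, so ~ is connectedness, and    *)
(* the Terwilliger algebra consists of the matrices M with M(ty,tz) = M(y,z)   *)
(* for which M(y,tz) = M(y,z) unless c(y) ~ c(z).                              *)
(* Such an M acts on the functions that are constant on fibres (a quotient     *)
(* matrix, restricted to the fibres whose size is invertible in F) and on the  *)
(* functions antisymmetric under the twin and supported on one class of ~.     *)
(* These are jointly surjective algebra maps onto full matrix algebras; every  *)
(* M in their common kernel K satisfies M^3 = 0, so K is the Jacobson radical, *)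
(* and K = 0 when 2 is invertible.                                             *)

Require Import Defs.
From HB Require Import structures.
From mathcomp Require Import all_boot all_order all_algebra all_field.
Set Implicit Arguments.
Unset Strict Implicit.
Unset Printing Implicit Defensive.
Import GRing.Theory.
Local Open Scope ring_scope.

(** The argument separates linear algebra from combinatorics. Given multiplicative linear maps onto
    full matrix algebras whose joint kernel is zero, with preimages that can be chosen to vanish
    under the other maps, the joint kernel of all maps but one is a minimal ideal isomorphic to the
    remaining matrix algebra, and these ideals decompose the algebra ([matrix_blocks]).
    [matrix_blocks_quotient] transfers this to a quotient by the joint kernel. On the combinatorial
    side, [simE] identifies [sim] with connectedness and [TerwilligerE] describes the Terwilliger
    algebra by two linear conditions on matrices. The maps fed into the algebraic part are
    [quot_mx], and [skew_mx] for each class; their joint kernel is the Jacobson radical by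
    [jacobsonP] and is zero by [kernel_odd] when 2 is invertible. *)

(** * Ideals that a linear map identifies with a full matrix algebra *)

Section MatrixBlock.
Variables (K : fieldType) (aT : falgType K) (m : nat) (f : 'Hom(aT, 'M[K]_m)).
Hypotheses (m_gt0 : (0 < m)%N) (fM : forall u v, f (u * v) = f u *m f v).

Variable U : {vspace aT}.
Hypotheses (Uideal : ideal_in fullv U) (fU : forall A, exists2 u, u \in U & f u = A)
  (Uker : forall u, u \in U -> f u = 0 -> u = 0).

(** A nonzero entry of [f w], multiplied on both sides by preimages in [U] of matrix units, yields
    every matrix unit inside [f @: W]. Injectivity of [f] on [U] then forces [W = U]. *)
Lemma block_simple : simple_alg U.
Proof.
split.
  apply/eqP => U0; have [u] := fU 1%:M.
  rewrite U0 memv0 => /eqP-> /matrixP/(_ (Ordinal m_gt0) (Ordinal m_gt0)).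
  by rewrite linear0 !mxE eqxx => /esym/eqP; rewrite oner_eq0.
move=> W /and3P[WU /prodvP UW /prodvP WU'].
have [-> | W0] := eqVneq W 0%VS; [by left | right].
apply/eqP; rewrite eqEsubv WU /=; apply/subvP => u Uu.
set w := vpick W; have Ww : w \in W by apply: memv_pick.
have Uw : w \in U by apply: subvP WU _ Ww.
have [i [j fwij]] : exists i j, f w i j != 0.
  apply/matrix0Pn; apply: contraNneq W0 => fw0.
  by rewrite -vpick0; apply/eqP/Uker.
have pre k l : delta_mx k l \in (f @: W)%VS.
  have [a Ua fa] := fU (delta_mx k i); have [b Ub fb] := fU (delta_mx j l).
  apply/memv_imgP; exists ((f w i j)^-1 *: (a * w * b)).
    by rewrite memvZ // WU' // UW.
  rewrite linearZ /= !fM fa fb; apply/matrixP => k' l'; rewrite !mxE.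
  rewrite (bigD1 j) //= big1 ?addr0 => [|l1 /negPf jl1]; last first.
    by rewrite !mxE jl1 /= mulr0.
  rewrite !mxE (bigD1 i) //= big1 ?addr0 => [|l1 /negPf il1]; last first.
    by rewrite !mxE il1 andbF mul0r.
  rewrite !mxE !eqxx /= andbT; case: (k' == k); case: (l' == l) => /=;
    by rewrite ?mulr0 ?mul0r ?mulr0 // mul1r mulr1 mulVf.
have /memv_imgP[w' Ww' fw'] : f u \in (f @: W)%VS.
  rewrite [f u]matrix_sum_delta.
  by apply: memv_suml => k _; apply: memv_suml => l _; rewrite memvZ.
suff /eqP: u - w' = 0 by rewrite subr_eq0 => /eqP->.
apply: Uker; last by rewrite linearB /= fw' subrr.
by rewrite memvB //; apply: subvP WU _ _.
Qed.

Lemma block_min_ideal : min_ideal U.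
Proof.
have [U0 simpleU] := block_simple; split=> // W /and3P[_ /prodvP Wl /prodvP Wr] WU.
apply: simpleU; rewrite /ideal_in WU /=; apply/andP.
by split; apply/prodvP => u v ? ?; [apply: Wl|apply: Wr]; rewrite ?memvf.
Qed.

Lemma block_has_algid : has_algid U.
Proof.
have [_ /prodvP UU _] := and3P Uideal.
have [e Ue fe] := fU 1%:M; apply/has_algidP; exists e; split=> //.
  apply/eqP => e0; move: fe; rewrite e0 linear0.
  move/matrixP/(_ (Ordinal m_gt0) (Ordinal m_gt0)).
  by rewrite !mxE eqxx => /esym/eqP; rewrite oner_eq0.
move=> u Uu; split; apply/eqP; rewrite -subr_eq0; apply/eqP/Uker.
- by rewrite memvB // UU // memvf.
- by rewrite linearB /= fM fe mul1mx subrr.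
- by rewrite memvB // UU // memvf.
- by rewrite linearB /= fM fe mulmx1 subrr.
Qed.

Lemma block_iso_mx : iso_mx U m.
Proof.
exists f; split=> [||u v _ _]; last exact: fM.
  apply/eqP; rewrite eqEsubv subvf; apply/subvP => A _.
  by have [u Uu <-] := fU A; rewrite memv_img.
apply/eqP; rewrite -subv0; apply/subvP => u; rewrite memv_cap memv_ker memv0.
by case/andP => Uu /eqP fu; rewrite (Uker Uu fu).
Qed.

Lemma matrix_block : [/\ min_ideal U, has_algid U, simple_alg U & iso_mx U m].
Proof.
split; [exact: block_min_ideal|exact: block_has_algid|exact: block_simple|].
exact: block_iso_mx.
Qed.

End MatrixBlock.

Lemma dim_iso_mx (K : fieldType) (aT : falgType K) (U : {vspace aT}) m :
  iso_mx U m -> \dim U = (m ^ 2)%N.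
Proof.
by case=> f [fU Uker _]; rewrite -(limg_dim_eq Uker) fU dimvf /dim /= mulnn.
Qed.

(** * Decomposition of an algebra along a family of matrix representations *)

Section Blocks.
Variables (K : fieldType) (aT : falgType K) (J : finType) (P : {set J}).
Variables (m0 : nat) (m : J -> nat).
Variables (f0 : 'Hom(aT, 'M[K]_m0)) (f : forall j, 'Hom(aT, 'M[K]_(m j))).
Hypotheses (m0_gt0 : (0 < m0)%N) (m_gt0 : forall j, j \in P -> (0 < m j)%N).
Hypothesis f0M : forall u v, f0 (u * v) = f0 u *m f0 v.
Hypothesis fM : forall j, j \in P -> forall u v, f j (u * v) = f j u *m f j v.
Hypothesis f0_onto :
  forall A, exists2 u, f0 u = A & forall j, j \in P -> f j u = 0.
Hypothesis f_onto : forall j, j \in P -> forall A,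
  exists2 u, f j u = A & forall i, i \in P -> i != j -> f i u = 0.
Hypothesis f_inj : forall u, f0 u = 0 -> (forall j, j \in P -> f j u = 0) -> u = 0.

(** Each block is the joint kernel of the maps belonging to the other blocks, so only its own map
    survives on it. *)
Let I0 : {vspace aT} := (\bigcap_(j in P) lker (f j))%VS.
Let I j : {vspace aT} := (lker f0 :&: \bigcap_(i in P | i != j) lker (f i))%VS.

Let memI0 u : reflect (forall j, j \in P -> f j u = 0) (u \in I0).
Proof.
rewrite memvE; apply: (iffP subv_bigcapP) => H j Pj.
  by apply/eqP; rewrite -memv_ker memvE H.
by rewrite -memvE memv_ker H.
Qed.

Let memI j u :
  reflect (f0 u = 0 /\ forall i, i \in P -> i != j -> f i u = 0) (u \in I j).
Proof.
rewrite memv_cap memv_ker [u \in _]memvE; apply: (iffP andP) => [[/eqP f0u]|[f0u fu]].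
  move/subv_bigcapP => H; split=> // i Pi ij; apply/eqP.
  by rewrite -memv_ker memvE H // Pi.
rewrite f0u; split=> //; apply/subv_bigcapP => i /andP[Pi ij].
by rewrite -memvE memv_ker fu.
Qed.

Let f0_ontoI A : exists2 u, u \in I0 & f0 u = A.
Proof. by have [u f0u fu] := f0_onto A; exists u => //; apply/memI0. Qed.

(** [f_onto] does not control [f0]. Subtracting an element with the same image under [f0], on which
    every [f i] vanishes, repairs this without changing [f j]. *)
Let f_ontoI j : j \in P -> forall A, exists2 u, u \in I j & f j u = A.
Proof.
move=> Pj A; have [u fju fu] := f_onto Pj A; have [v f0v fv] := f0_onto (f0 u).
exists (u - v); last by rewrite linearB /= fju fv ?subr0.
apply/memI; rewrite linearB /= f0v subrr; split=> // i Pi ij.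
by rewrite linearB /= fv // fu // subr0.
Qed.

Let I0_ideal : ideal_in fullv I0.
Proof.
rewrite /ideal_in subvf /=; apply/andP.
split; apply/prodvP => u v; [move=> _ /memI0 v0 | move=> /memI0 u0 _];
  apply/memI0 => j Pj; by rewrite fM // ?u0 ?v0 ?mulmx0 ?mul0mx.
Qed.

Let I_ideal j : ideal_in fullv (I j).
Proof.
rewrite /ideal_in subvf /=; apply/andP.
split; apply/prodvP => u v; [move=> _ /memI[v0 v1] | move=> /memI[u0 u1] _];
  apply/memI; split => [|i Pi ij];
  by rewrite ?f0M ?fM // ?u0 ?u1 ?v0 ?v1 ?mulmx0 ?mul0mx.
Qed.

(** The blocks span because [u] minus suitable preimages of its images is killed by every map; the
    sum is direct because the map of a block kills the sum of the others. *)
Lemma matrix_blocks :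
  exists (I0 : {vspace aT}) (I : J -> {vspace aT}),
    [/\ [/\ min_ideal I0, has_algid I0, simple_alg I0 & iso_mx I0 m0],
        forall j, j \in P -> [/\ min_ideal (I j), has_algid (I j) & iso_mx (I j) (m j)],
        (I0 + \sum_(j in P) I j)%VS = fullv &
        directv (I0 + \sum_(j in P) I j)].
Proof.
have I0_inj u : u \in I0 -> f0 u = 0 -> u = 0 by move/memI0 => u0 /f_inj; apply.
have I_inj j u : u \in I j -> f j u = 0 -> u = 0.
  case/memI => u0 u1 fju; apply: f_inj => // i Pi.
  by have [->|ij] := eqVneq i j; [|exact: u1].
exists I0, I; split.
- exact: (matrix_block m0_gt0 f0M I0_ideal f0_ontoI).
- move=> j Pj.
  by case: (matrix_block (m_gt0 Pj) (fM Pj) (I_ideal j) (f_ontoI Pj)) => // u; apply: I_inj.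
- apply/eqP; rewrite eqEsubv subvf; apply/subvP => u _.
  have [v0 Iv0 fv0] := f0_ontoI (f0 u).
  (* The components are chosen for all [j] at once through a boolean predicate; outside [P] it is
     vacuous and 0 serves. *)
  have pre j : {v | j \in P -> v \in I j & j \in P -> f j v = f j u}.
    have: exists v, (j \in P) ==> (v \in I j) && (f j v == f j u).
      have [Pj|] := boolP (j \in P); last by exists 0.
      by have [v Iv fv] := f_ontoI Pj (f j u); exists v; rewrite Iv fv /=.
    by case/sigW => v /implyP H; exists v => /H/andP[] // _ /eqP.
  have Ipre j : j \in P -> s2val (pre j) \in I j by case: (pre j).
  have fpre j : j \in P -> f j (s2val (pre j)) = f j u by case: (pre j).
  suff ->: u = v0 + \sum_(j in P) s2val (pre j).
    by apply: memv_add => //; apply: memv_sumr.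
  apply/eqP; rewrite -subr_eq0; apply/eqP/f_inj.
    rewrite linearB linearD linear_sum /= fv0 big1 ?addr0 ?subrr // => j Pj.
    by case/memI: (Ipre j Pj).
  move=> j Pj; rewrite linearB linearD linear_sum /= (bigD1 j) //= fpre //.
  rewrite big1 => [|i /andP[Pi ij]]; last first.
    by case/memI: (Ipre i Pi) => _ -> //; rewrite eq_sym.
  by move/memI0: Iv0 => ->; rewrite // add0r addr0 subrr.
rewrite directv_addE /= directv_trivial /=; apply/andP; split.
  apply/directv_sumP => j Pj; apply/eqP; rewrite -subv0; apply/subvP => u.
  rewrite memv_cap memv0 => /andP[Iu Su]; apply/eqP/(I_inj j) => //.
  apply/eqP; rewrite -memv_ker; apply: subvP Su; apply/subv_sumP => i /andP[Pi ij].
  by apply/subvP => v /memI[_ H]; rewrite memv_ker H // eq_sym.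
rewrite -subv0; apply/subvP => u; rewrite memv_cap memv0 => /andP[Iu Su].
apply/eqP/I0_inj => //; apply/eqP; rewrite -memv_ker; apply: subvP Su.
by apply/subv_sumP => j Pj; apply/subvP => v /memI[H _]; rewrite memv_ker H.
Qed.

End Blocks.

(** * The Jacobson radical, bounded from above and from below *)

Section Jacobson.
Variables (K : fieldType) (aT : falgType K).

(** For each [j], the elements whose image has zero column [j] form a maximal left ideal; together
    these ideals meet in the kernel of [f]. *)
Lemma in_jacobson_mx_kernel m (f : 'Hom(aT, 'M[K]_m)) (t : aT) :
    (forall u v, f (u * v) = f u *m f v) -> (forall A, exists u, f u = A) ->
  in_jacobson t -> f t = 0.
Proof.
move=> fM f_onto Jt; apply/matrixP => i j; rewrite [RHS]mxE.
pose L := lker (linfun (col j \o f)).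
have memL u : (u \in L) = (col j (f u) == 0) by rewrite memv_ker lfunE.
suff: t \in L by rewrite memL => /eqP/colP/(_ i); rewrite !mxE.
apply: Jt; split.
- apply/prodvP => u v _; rewrite !memL fM => /eqP v0.
  by rewrite !colE -mulmxA -colE v0 mulmx0.
- apply/eqP => L1; have [u fu] := f_onto 1%:M; have := memvf u.
  rewrite -L1 memL fu => /eqP/colP/(_ j)/eqP.
  by rewrite !mxE eqxx oner_eq0.
move=> L' L'ideal LL'; have [<-|neqL] := eqVneq L L'; [by left | right].
have /subvPn[v L'v Lv] : ~~ (L' <= L)%VS by apply: contra neqL; rewrite eqEsubv LL'.
have [i0 fvi] : exists k, f v k j != 0.
  move: Lv; rewrite memL => /cV0Pn[k]; rewrite mxE; by exists k.
apply/eqP; rewrite eqEsubv subvf; apply/subvP => u _.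
(* The image of [a] has only column [i0], scaled so that [f (a * v)] and [f u] share column [j];
   hence [u - a * v] lies in [L]. *)
have [a fa] := f_onto (\matrix_(k, l) (if l == i0 then f u k j / f v i0 j else 0)).
rewrite -[u](subrK (a * v)) memvD //; last first.
  by move/prodvP: L'ideal; apply; rewrite ?memvf.
apply: subvP LL' _ _; rewrite memL linearB /= fM; apply/eqP/colP => k.
rewrite fa !mxE (bigD1 i0) //= big1 => [|l /negPf li]; rewrite !mxE.
  by rewrite eqxx addr0 mulfVK // subrr.
by rewrite li mul0r.
Qed.

(** If a maximal left ideal [L] misses [t], then [1 - a * t] is in [L] for some [a]; the truncated
    geometric series is a left inverse of it, so [L] contains 1. *)
Lemma nil_in_jacobson (t : aT) : (forall a, (a * t) ^+ 3 = 0) -> in_jacobson t.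
Proof.
move=> t_nil L [/prodvP Lideal L1 Lmax]; apply: contraR L1 => Lt.
have L'ideal : left_ideal (L + fullv * <[t]>)%VS.
  apply/prodvP => u v _ /memv_addP[l Ll [w]].
  rewrite -limg_amulr => /memv_imgP[a _ ->] ->; rewrite lfunE /= mulrDr mulrA.
  rewrite memv_add ?Lideal ?memvf //.
  by apply/memv_imgP; exists (u * a); rewrite ?memvf ?lfunE.
case: (Lmax _ L'ideal (addvSl _ _)) => L'E.
  case/negP: Lt; rewrite -L'E; apply: (subvP (addvSr _ _)).
  by rewrite -[X in X \in _]mul1r memv_mul ?memvf ?memv_line.
have : 1 \in (L + fullv * <[t]>)%VS by rewrite L'E memvf.
case/memv_addP => l Ll [w]; rewrite -limg_amulr => /memv_imgP[a _ ->].
rewrite lfunE /= => one.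
have L1 : 1 \in L.
  have <- : (1 + a * t + (a * t) ^+ 2) * l = 1; last by rewrite Lideal ?memvf.
  have -> : l = 1 - a * t by rewrite one addrK.
  rewrite mulrBr mulr1 !mulrDl mul1r -expr2 -exprSr t_nil addr0.
  by rewrite -[1 + _ + _]addrA addrK.
by apply/eqP/vspaceP => u; rewrite memvf -[u]mulr1 Lideal ?memvf.
Qed.

End Jacobson.

(** * The same decomposition for a quotient algebra *)

Section BlocksOfQuotient.
Variables (K : fieldType) (aT bT : falgType K) (pi : 'AHom(aT, bT)).
Variables (J : finType) (P : {set J}) (m0 : nat) (m : J -> nat).
Variables (f0 : 'Hom(aT, 'M[K]_m0)) (f : forall j, 'Hom(aT, 'M[K]_(m j))).
Hypotheses (m0_gt0 : (0 < m0)%N) (m_gt0 : forall j, j \in P -> (0 < m j)%N).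
Hypothesis f0M : forall u v, f0 (u * v) = f0 u *m f0 v.
Hypothesis fM : forall j, j \in P -> forall u v, f j (u * v) = f j u *m f j v.
Hypothesis f0_onto :
  forall A, exists2 u, f0 u = A & forall j, j \in P -> f j u = 0.
Hypothesis f_onto : forall j, j \in P -> forall A,
  exists2 u, f j u = A & forall i, i \in P -> i != j -> f i u = 0.
Hypothesis pi_onto : limg pi = fullv.
Hypothesis pi_ker : forall u,
  u \in lker pi <-> f0 u = 0 /\ forall j, j \in P -> f j u = 0.

(** A linear section [s] of [pi] need not be multiplicative, but its defect lies in the kernel of
    [pi], where all the maps vanish; so their composites with [s] are multiplicative. *)
Lemma matrix_blocks_quotient :
  exists (K0 : {vspace bT}) (KK : J -> {vspace bT}),
    [/\ [/\ min_ideal K0, has_algid K0, simple_alg K0 & iso_mx K0 m0],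
        forall j, j \in P -> [/\ min_ideal (KK j), has_algid (KK j) & iso_mx (KK j) (m j)],
        (K0 + \sum_(j in P) KK j)%VS = fullv &
        directv (K0 + \sum_(j in P) KK j)].
Proof.
pose s := (pi^-1)%VF; have piK v : pi (s v) = v by apply: limg_lfunVK; rewrite pi_onto memvf.
have ker_eq u v : pi u = pi v -> f0 u = f0 v /\ forall j, j \in P -> f j u = f j v.
  move=> uv; have /pi_ker[uv0 uv1] : u - v \in lker pi.
    by rewrite memv_ker linearB /= uv subrr.
  split=> [|j Pj]; apply/eqP; rewrite -subr_eq0.
    by rewrite linearB in uv0; rewrite uv0.
  by have := uv1 j Pj; rewrite linearB => ->.
have sK u : f0 (s (pi u)) = f0 u /\ forall j, j \in P -> f j (s (pi u)) = f j u.
  by apply: ker_eq; rewrite piK.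
have sM u v : f0 (s (u * v)) = f0 (s u * s v) /\
    forall j, j \in P -> f j (s (u * v)) = f j (s u * s v).
  by apply: ker_eq; rewrite rmorphM /= !piK.
apply: (@matrix_blocks _ _ _ _ _ m (f0 \o s)%VF (fun j => (f j \o s)%VF)) => //.
- by move=> u v; rewrite !comp_lfunE (sM u v).1.
- by move=> j Pj u v; rewrite !comp_lfunE (sM u v).2 // fM.
- move=> A; have [u f0u fu] := f0_onto A; exists (pi u).
    by rewrite comp_lfunE (sK u).1.
  by move=> j Pj; rewrite comp_lfunE (sK u).2 // fu.
- move=> j Pj A; have [u fju fu] := f_onto Pj A; exists (pi u).
    by rewrite comp_lfunE (sK u).2.
  by move=> i Pi ij; rewrite comp_lfunE (sK u).2 // fu.
move=> u f0u fu; rewrite -[u]piK; apply/eqP; rewrite -memv_ker; apply/pi_ker.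
rewrite -[f0 _]comp_lfunE f0u; split=> // j Pj.
by rewrite -[f j _]comp_lfunE fu.
Qed.

End BlocksOfQuotient.

(** * Fibres, twins and connectedness in a quasi-thin scheme *)

Section QuasiThin.
Variables (N d : nat) (r : 'I_N.+1 -> 'I_N.+1 -> 'I_d.+1) (x : 'I_N.+1).
Hypothesis schemeP : is_scheme r.

Lemma relC u v u' v' : r u v = r u' v' -> r v u = r v' u'.
Proof.
case: schemeP => _ [_ [/(_ (r v u))[c' c'P] _]] ruv; apply/esym/c'P.
by rewrite -ruv; apply/c'P.
Qed.

Lemma rel_diag y : r y y = ord0.
Proof. by case: schemeP => _ [/(_ y y) + _]; rewrite eqxx => /eqP. Qed.

Lemma relP a : exists y z, r y z = a.
Proof. by case: schemeP => /(_ a). Qed.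

Lemma pnum_rel i j m n m' n' : r m n = r m' n' -> pnum r i j m n = pnum r i j m' n'.
Proof. by case: schemeP => _ [_ [_ H]] rmn; apply: (H _ _ (r m n)). Qed.

(** A triangle over one pair makes an intersection number positive, so it can be transported to any
    pair in the same relation. *)
Lemma rel_triangle m n m' n' l :
  r m n = r m' n' -> exists2 l', r m' l' = r m l & r l' n' = r l n.
Proof.
move/(pnum_rel (r m l) (r l n)) => pE.
have : (0 < pnum r (r m l) (r l n) m' n')%N.
  by rewrite -pE; apply/card_gt0P; exists l; rewrite inE !eqxx.
by case/card_gt0P => l'; rewrite inE => /andP[/eqP ? /eqP ?]; exists l'.
Qed.

Lemma intnumE i j m n : intnum r i j (r m n) = pnum r i j m n.
Proof.
rewrite /intnum; case: pickP => [[m' n'] /= /eqP/pnum_rel-> //|/(_ (m, n))].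
by rewrite eqxx.
Qed.

Lemma trindE a y z : (r y z == trind r a) = (r z y == a).
Proof.
rewrite /trind; case: pickP => [c' /forallP/(_ y)/forallP/(_ z)/eqP //|].
case: schemeP => _ [_ [/(_ a)[c' c'P] _]] /(_ c')/negP[].
apply/forallP => u; apply/forallP => v.
by apply/eqP; apply/idP/idP => /eqP/c'P/eqP.
Qed.

Lemma fibre_surj a : exists z, r x z = a.
Proof.
have [y [z <-]] := relP a; have yx : r y y = r x x by rewrite !rel_diag.
by have [l xl _] := rel_triangle z yx; exists l.
Qed.

Lemma valencyE a : valency r a = #|[set z | r x z == a]|.
Proof.
rewrite /valency -(rel_diag x) intnumE; apply: eq_card => z.
by rewrite !inE trindE andbb.
Qed.

Definition rep a := odflt x [pick z | r x z == a].

(* [twin y = y] when the fibre of [y] is a singleton. *)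
Definition twin y := odflt y [pick z | (r x z == r x y) && (z != y)].

Lemma rel_rep a : r x (rep a) = a.
Proof.
rewrite /rep; case: pickP => [z /eqP //|]; have [z <-] := fibre_surj a.
by move/(_ z); rewrite eqxx.
Qed.

Lemma rel_twin y : r x (twin y) = r x y.
Proof. by rewrite /twin; case: pickP => //= z /andP[/eqP]. Qed.

Hypothesis qthin : quasi_thin r.

(** A third point in the fibre would push the valency above 2. *)
Lemma fibreP y z : r x z = r x y -> z = y \/ z = twin y.
Proof.
move=> rz; have [->|zy] := eqVneq z y; [by left | right].
rewrite /twin; case: pickP => /= [z' /andP[/eqP rz' z'y]|/(_ z)]; last by rewrite rz zy eqxx.
apply/eqP; apply: contraTT (qthin (r x y)) => zz'; rewrite valencyE -ltnNge.
have <- : #|y |: [set z; z']| = 3%N.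
  by rewrite cardsU1 cards2 zz' !inE negb_or eq_sym zy eq_sym z'y.
by apply/subset_leq_card/subsetP => u; rewrite !inE => /or3P[]/eqP->; apply/eqP.
Qed.

Lemma twinK : involutive twin.
Proof.
move=> y; have /fibreP[yy|//] : r x y = r x (twin y) by rewrite rel_twin.
by rewrite -!yy.
Qed.

Lemma twin_eq y z : (r x z == r x y) = (z == y) || (z == twin y).
Proof.
apply/eqP/orP => [/fibreP[]->|[]/eqP->]; rewrite ?eqxx ?rel_twin //; [by left|by right].
Qed.

Lemma fibreE y : [set z | r x z == r x y] = [set y; twin y].
Proof. by apply/setP => z; rewrite !inE twin_eq. Qed.

Lemma Aset2E y : (r x y \in Aset r 2) = (twin y != y).
Proof. by rewrite inE valencyE fibreE cards2 eqSS eqb1 eq_sym. Qed.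

Lemma Aset1E y : (r x y \in Aset r 1) = (twin y == y).
Proof. by rewrite inE valencyE fibreE cards2 eqSS eqb0 negbK eq_sym. Qed.

Lemma rel_twin_sub y y' z :
  r x y' = r x y -> r y' z = r y z \/ r y' (twin z) = r y z.
Proof.
move=> ry; have [l xl lz] := @rel_triangle x y x y' z (esym ry).
by move/relC: lz; have [->|->] := fibreP xl; [left|right].
Qed.

(** Transporting triangles from [x] settles every case except a row of the block that is constant at
    [y]; that row transports to the same constant at [twin y]. *)
Lemma rel_twin2 y z : r (twin y) (twin z) = r y z.
Proof.
have [_|//] := rel_twin_sub z (rel_twin y).
have [/relC zy|/relC //] := rel_twin_sub y (rel_twin z).
have [|] := rel_twin_sub (twin z) (esym (rel_twin y)); last by rewrite twinK.
by rewrite zy.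
Qed.

Lemma rel_twinl y z : r (twin y) z = r y (twin z).
Proof. by rewrite -rel_twin2 twinK. Qed.

(** Every triangle witnessing a relation of the product can be moved to have apex [x] and first
    endpoint [y]; its second endpoint then lies in the fibre of [z]. *)
Lemma cprodE y z : cprod r (trind r (r x y)) (r x z) = [set r y z; r y (twin z)].
Proof.
apply/setP => e; have [m [n <-]] := relP e; rewrite inE intnumE inE !inE.
apply/card_gt0P/orP => [[l]|[]/eqP mn].
- rewrite inE trindE => /andP[/eqP lm /eqP ln].
  have [n' xn' n'y] := @rel_triangle l m x y n lm.
  have /fibreP[<-|<-] : r x n' = r x z by rewrite xn'.
    by left; rewrite (relC n'y).
  by right; rewrite (relC n'y).
- have [l ml ln] := @rel_triangle y z m n x (esym mn).
  by exists l; rewrite inE trindE (relC ml) ln !eqxx.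
- have [l ml ln] := @rel_triangle y (twin z) m n x (esym mn).
  by exists l; rewrite inE trindE (relC ml) ln rel_twin !eqxx.
Qed.

Definition adj a b :=
  [&& a \in Aset r 2, b \in Aset r 2 & #|cprod r (trind r a) b| == 2%N].

Definition conn a b := [&& a \in Aset r 2, b \in Aset r 2 & connect adj a b].

Lemma adjE y z :
  adj (r x y) (r x z) = [&& twin y != y, twin z != z & r y z != r y (twin z)].
Proof. by rewrite /adj !Aset2E cprodE cards2 eqSS eqb1. Qed.

Lemma adj_sym : symmetric adj.
Proof.
move=> a b; rewrite -(rel_rep a) -(rel_rep b) !adjE andbCA; congr [&& _, _ & ~~ _].
by apply/eqP/eqP => /relC; rewrite rel_twinl.
Qed.

Lemma adj_refl a : a \in Aset r 2 -> adj a a.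
Proof.
rewrite -(rel_rep a) Aset2E adjE => yy; rewrite yy /= rel_diag eq_sym.
by case: schemeP => _ [-> _]; rewrite eq_sym.
Qed.

Lemma connC : symmetric conn.
Proof. by move=> a b; rewrite /conn andbCA (sym_connect_sym adj_sym). Qed.

Lemma conn_trans : transitive conn.
Proof.
move=> b a c /and3P[A2a A2b ab] /and3P[_ A2c bc].
by rewrite /conn A2a A2c (connect_trans ab bc).
Qed.

Lemma conn_refl a : a \in Aset r 2 -> conn a a.
Proof. by move=> A2a; rewrite /conn A2a connect0. Qed.

Lemma adj_conn a b : adj a b -> conn a b.
Proof. by move=> ab; have /and3P[A2a A2b _] := ab; rewrite /conn A2a A2b connect1. Qed.

(* The links of the chain in [bad_pair] are the edges of [adj]. *)
Lemma adj_intnum i l : i \in Aset r 2 -> l \in Aset r 2 ->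
  adj i l <-> exists j, intnum r i j l = 1%N.
Proof.
rewrite -(rel_rep i) -(rel_rep l) !Aset2E adjE; set y := rep i; set w := rep l.
move=> yy ww; rewrite yy ww /= -rel_twinl; split=> [neq|[j]].
  exists (r y w); rewrite intnumE /pnum -(cards1 y); apply: eq_card => z.
  rewrite !inE twin_eq; have [->|_] /= := eqVneq z y; first by rewrite eqxx.
  by apply/negP => /andP[/eqP->]; rewrite eq_sym (negPf neq).
(* If the column of [w] is constant, the number of points counted is 0 or 2, never 1. *)
rewrite intnumE /pnum; apply: contra_eqN => /eqP ywE.
have -> : [set z | (r x z == r x y) && (r z w == j)] =
  if r y w == j then [set y; twin y] else set0.
  apply/setP => z; rewrite inE twin_eq; case: ifP => yw; rewrite !inE.
    by case: eqVneq => [->|_]; case: eqVneq => [->|_] //=; rewrite -?ywE yw.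
  by case: eqVneq => [->|_]; case: eqVneq => [->|_] //=; rewrite -?ywE yw.
by case: ifP => _; rewrite ?cards0 // cards2 [y == _]eq_sym yy.
Qed.

Lemma card_cprod a b : a \in Aset r 2 -> b \in Aset r 2 ->
  #|cprod r (trind r a) b| = (adj a b).+1.
Proof.
move=> A2a A2b; rewrite /adj A2a A2b /=; have := cprodE (rep a) (rep b).
by rewrite !rel_rep => ->; rewrite cards2 eqSS eqb1.
Qed.

Lemma bad_pair_conn u v : bad_pair r u v -> conn u v.
Proof.
case=> n [i [j [l [_ [<- <-] step glue _]]]].
have {}step b : (b <= n)%N -> conn (i b) (l b).
  move=> /step[/eqP ib /eqP lb ilb]; apply: adj_conn.
  by apply/adj_intnum; rewrite ?inE //; exists (j b).
suff H b : (b <= n)%N -> conn (i 0%N) (l b) by apply: H.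
elim: b => [|b IHb] lebn; first exact: step.
apply: conn_trans (step _ lebn); rewrite -glue //; exact: IHb (ltnW lebn).
Qed.

Lemma simE u v : u \in Aset r 2 -> v \in Aset r 2 -> sim r u v <-> conn u v.
Proof.
move=> A2u A2v; split=> [[uv|/bad_pair_conn//]|].
  by apply: adj_conn; rewrite /adj A2u A2v uv.
case/and3P => _ _ /connectP[p pP vE].
have [uv|nuv] := boolP (adj u v); first by left; rewrite card_cprod ?uv.
(* A path with no edge or one edge would make [u] and [v] adjacent, so the chain has the index
   [a >= 1] that [bad_pair] demands. *)
right; have p_gt1 : (1 < size p)%N.
  case: p pP vE nuv => [_ ->|e [|//]] /=; first by rewrite adj_refl.
  by rewrite andbT => ue ->; rewrite ue.
have step b : (b < size p)%N -> adj (nth u (u :: p) b) (nth u p b).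
  by move=> bp; apply: (pathP u pP).
have jP b : exists j, (b < size p)%N ==>
    (intnum r (nth u (u :: p) b) j (nth u p b) == 1%N).
  case: ltnP => [/step bp|_]; last by exists ord0.
  have /and3P[A2b A2b' _] := bp.
  by have [j /eqP jE] := (adj_intnum A2b A2b').1 bp; exists j.
(* The sequences list the sources and targets of successive edges, so the gluing condition holds by
   computation; the last index is the number of edges minus one. *)
exists (size p).-1, (nth u (u :: p)), (fun b => xchoose (jP b)), (nth u p).
split=> //.
- by rewrite -ltnS prednK // ltnW.
- by split; rewrite // nth_last vE; case: (p) p_gt1.
- move=> b bp; have {}bp : (b < size p)%N by rewrite -ltnS prednK // ltnW in bp.
  have /and3P[+ + _] := step b bp; rewrite !inE => /eqP ? /eqP ?; split=> //.
  by have /implyP/(_ bp)/eqP := xchooseP (jP b).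
- by rewrite card_cprod ?(negPf nuv).
Qed.

Lemma sim_equiv : equiv_on (Aset r 2) (sim r).
Proof.
split=> [b A2b|b c A2b A2c|b c e A2b A2c A2e].
- by apply/simE => //; apply: conn_refl.
- by move=> /(simE A2b A2c) bc; apply/simE => //; rewrite connC.
- move=> /(simE A2b A2c) bc /(simE A2c A2e) ce.
  by apply/simE => //; apply: conn_trans ce.
Qed.

(** A connected component of [conn], described without choosing a representative. *)
Definition closed_class (C : {set 'I_d.+1}) :=
  [/\ (0 < #|C|)%N, C \subset Aset r 2, {in C &, forall a b, conn a b} &
      forall a b, a \in C -> conn a b -> b \in C].

Lemma classP P C :
  is_classes (Aset r 2) (sim r) P -> C \in P -> closed_class C.
Proof.
move=> clP /clP[b A2b CE]; have {}CE c : (c \in C) = conn b c.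
  apply/idP/idP => [/CE[A2c /simE]|bc]; first by apply.
  by have /and3P[_ A2c _] := bc; apply/CE; split=> //; apply/simE.
split.
- by apply/card_gt0P; exists b; rewrite CE conn_refl.
- by apply/subsetP => c; rewrite CE => /and3P[].
- by move=> a e; rewrite !CE connC; apply: conn_trans.
- by move=> a e; rewrite !CE; apply: conn_trans.
Qed.

Lemma class_exists P a : is_classes (Aset r 2) (sim r) P -> a \in Aset r 2 ->
  exists2 C, C \in P & forall b, (b \in C) = conn a b.
Proof.
move=> clP A2a; exists [set b | conn a b]; last by move=> b; rewrite inE.
apply/clP; exists a => // c; rewrite inE; split=> [ac|[A2c /simE]]; last by apply.
by have /and3P[_ A2c _] := ac; split=> //; apply/simE.
Qed.

End QuasiThin.

(** * Determination of the Terwilliger algebra *)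

Section Twinned.
Variables (F : fieldType) (N d : nat).
Variables (r : 'I_N.+1 -> 'I_N.+1 -> 'I_d.+1) (x : 'I_N.+1).

Local Notation twin := (twin r x).
Local Notation rep := (rep r x).
Local Notation conn := (conn r).
Local Notation c := (r x).
Local Notation T := (Terwilliger F r x).

(* The conditions cutting out [twinned] are packaged as kernels of linear maps
   so that [agenv_sub_modr] applies. *)
Definition twin_defect (M : 'M[F]_N.+1) : 'M[F]_N.+1 :=
  \matrix_(y, z) (M (twin y) (twin z) - M y z).

Definition conn_defect (M : 'M[F]_N.+1) : 'M[F]_N.+1 :=
  \matrix_(y, z) (if conn (c y) (c z) then 0 else M y (twin z) - M y z).

Lemma twin_defect_linear : linear twin_defect.
Proof.
move=> a A B; apply/matrixP => y z; rewrite !mxE.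
by rewrite opprD addrACA -mulrBr.
Qed.

Lemma conn_defect_linear : linear conn_defect.
Proof.
move=> a A B; apply/matrixP => y z; rewrite !mxE; case: ifP => _.
  by rewrite mulr0 addr0.
by rewrite opprD addrACA -mulrBr.
Qed.

HB.instance Definition _ :=
  GRing.isLinear.Build F 'M[F]_N.+1 'M[F]_N.+1 _ twin_defect twin_defect_linear.
HB.instance Definition _ :=
  GRing.isLinear.Build F 'M[F]_N.+1 'M[F]_N.+1 _ conn_defect conn_defect_linear.

Definition twinned : {vspace 'M[F]_N.+1} :=
  (lker (linfun twin_defect) :&: lker (linfun conn_defect))%VS.

Lemma twinnedP (M : 'M[F]_N.+1) :
  reflect ((forall y z, M (twin y) (twin z) = M y z) /\
           forall y z, ~~ conn (c y) (c z) -> M y (twin z) = M y z)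
          (M \in twinned).
Proof.
rewrite memv_cap !memv_ker !lfunE /=.
apply: (iffP andP) => [[/eqP/matrixP H1 /eqP/matrixP H2]|[H1 H2]]; split.
- by move=> y z; have := H1 y z; rewrite !mxE => /eqP; rewrite subr_eq0 => /eqP.
- move=> y z /negPf nc; have := H2 y z; rewrite !mxE nc => /eqP.
  by rewrite subr_eq0 => /eqP.
- by apply/eqP/matrixP => y z; rewrite !mxE H1 subrr.
by apply/eqP/matrixP => y z; rewrite !mxE; case: ifPn => // /H2->; rewrite subrr.
Qed.

Hypotheses (schemeP : is_scheme r) (qthin : quasi_thin r).

Let twK := twinK x schemeP qthin.
Let c_twin y : c (twin y) = c y := rel_twin r x y.
Let c_rep a : c (rep a) = a := rel_rep x schemeP a.

Lemma nconn_eq y z : ~~ conn (c y) (c z) -> (y == twin z) = (y == z).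
Proof.
move=> nc; have [->//|zz] := eqVneq (twin z) z.
apply/eqP/eqP => yE; case/negP: nc.
all: by rewrite yE ?c_twin conn_refl // Aset2E.
Qed.

(** Between two fibres of size 2 a nonconstant row is an edge of [adj]; if either fibre is a
    singleton, there is nothing to distinguish, by [rel_twin2]. *)
Lemma nconn_rel y z : ~~ conn (c y) (c z) -> r y (twin z) = r y z.
Proof.
move=> nc; have [yy|ty] := eqVneq (twin y) y; first by rewrite -{1}yy rel_twin2.
have [->//|tz] := eqVneq (twin z) z; apply/esym/eqP; apply: contraNT nc => yz.
by apply: adj_conn; rewrite adjE // ty tz.
Qed.

Lemma mem1_twinned : 1 \in twinned.
Proof.
apply/twinnedP; split=> y z; first by rewrite !mxE (inj_eq (inv_inj twK)).
by move=> nc; rewrite !mxE nconn_eq.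
Qed.

Lemma adjm_twinned a : adjm F r a \in twinned.
Proof.
apply/twinnedP; split=> y z; first by rewrite !mxE rel_twin2.
by move=> nc; rewrite !mxE nconn_rel.
Qed.

Lemma dualE_twinned a : dualE F r x a \in twinned.
Proof.
apply/twinnedP; split=> y z; first by rewrite !mxE (inj_eq (inv_inj twK)) c_twin.
by move=> nc; rewrite !mxE nconn_eq.
Qed.

Lemma twinned_shift (M : 'M[F]_N.+1) y z : M \in twinned -> M (twin y) z = M y (twin z).
Proof. by case/twinnedP => + _ => /(_ y (twin z)); rewrite twK. Qed.

Lemma sum_twin (R : nmodType) (Q : pred 'I_N.+1) (h : 'I_N.+1 -> R) :
  (forall z, Q (twin z) = Q z) -> \sum_(z | Q z) h z = \sum_(z | Q z) h (twin z).
Proof.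
move=> QE; rewrite (reindex_inj (inv_inj twK)) /=.
by apply: eq_bigl.
Qed.

(** For the second condition, split the sum over the middle point [z]: if [z] is not connected to
    [w], then [B] absorbs the twin; otherwise transitivity separates [y] from [z], and [A] absorbs
    it after reindexing. *)
Lemma twinned_mul (A B : 'M[F]_N.+1) : A \in twinned -> B \in twinned -> A * B \in twinned.
Proof.
move=> TA TB; have [A1 A2] := twinnedP _ TA; have [B1 B2] := twinnedP _ TB.
apply/twinnedP; split=> y w; rewrite !mxE.
  by rewrite sum_twin //; apply: eq_bigr => z _; rewrite A1 B1.
move=> nc; rewrite (bigID (fun z => conn (c z) (c w))) [RHS](bigID (fun z => conn (c z) (c w))) /=.
congr (_ + _); last by apply: eq_bigr => z zw; rewrite B2.
rewrite sum_twin => [|z]; last by rewrite c_twin.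
apply: eq_bigr => z zw; rewrite twinned_shift // twK A2 //.
by apply: contra nc => yz; apply: conn_trans yz zw.
Qed.

Lemma adjm_mem a : adjm F r a \in T.
Proof.
apply: subvP (sub_agenv _) _ _; rewrite memvE (sumv_sup a) //.
by rewrite (subv_trans _ (addvSl _ _)) // -memvE memv_line.
Qed.

Lemma dualE_mem a : dualE F r x a \in T.
Proof.
apply: subvP (sub_agenv _) _ _; rewrite memvE (sumv_sup a) //.
by rewrite (subv_trans _ (addvSr _ _)) // -memvE memv_line.
Qed.

Lemma Terwilliger_twinned : (T <= twinned)%VS.
Proof.
apply: agenv_sub_modr; first by rewrite -memvE mem1_twinned.
apply: subv_trans (prodvSr twinned _) (_ : twinned * twinned <= twinned)%VS.
  apply/subv_sumP => a _; rewrite subv_add -!memvE adjm_twinned.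
  exact: dualE_twinned.
by apply/prodvP => A B; apply: twinned_mul.
Qed.

Lemma dualE_mulE a b (M : 'M[F]_N.+1) y z :
  (dualE F r x a * M * dualE F r x b) y z = if (c y == a) && (c z == b) then M y z else 0.
Proof.
rewrite !mxE (bigD1 z) //= big1 ?addr0 => [|w /negPf wz]; last first.
  by rewrite !mxE wz mulr0.
rewrite !mxE (bigD1 y) //= big1 ?addr0 => [|w wy]; last first.
  by rewrite !mxE eq_sym (negPf wy) mul0r.
rewrite !mxE !eqxx; case: (c y == a); case: (c z == b) => /=;
by rewrite ?mulr0 ?mul0r ?mulr1 ?mul1r.
Qed.

Lemma dualE_mul_mem a b (M : 'M[F]_N.+1) : M \in T -> dualE F r x a * M * dualE F r x b \in T.
Proof. by move=> TM; rewrite !memvM ?dualE_mem. Qed.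

(** The adjacency matrices sum to the all-ones matrix, which the dual idempotents cut down to one
    block. *)
Lemma block_const_mem a b :
  (\matrix_(y, z) ((c y == a) && (c z == b))%:R : 'M[F]_N.+1) \in T.
Proof.
have TS : \sum_e adjm F r e \in T by apply: memv_suml => e _; apply: adjm_mem.
rewrite (_ : \matrix_(y, z) _ = dualE F r x a * (\sum_e adjm F r e) * dualE F r x b).
  exact: dualE_mul_mem.
apply/matrixP => y z; rewrite dualE_mulE !mxE summxE.
case: ifP => // _; rewrite (bigD1 (r y z)) //= big1 ?addr0 ?mxE ?eqxx // => e.
by rewrite eq_sym mxE => /negPf->.
Qed.

(* The permutation block on xR_a * xR_b that matches y0 with z0. *)
Definition pairing y0 z0 : 'M[F]_N.+1 :=
  \matrix_(y, z) (((y == y0) && (z == z0)) || ((y == twin y0) && (z == twin z0)))%:R.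

(** In an adjacent block, the relation [r y0 z0] occurs exactly at [(y0, z0)] and at its twin
    position. *)
Lemma adj_pairing_mem y0 z0 : adj r (c y0) (c z0) -> pairing y0 z0 \in T.
Proof.
rewrite adjE // => /and3P[yy zz /negPf yz].
rewrite (_ : pairing _ _ = dualE F r x (c y0) * adjm F r (r y0 z0) * dualE F r x (c z0)).
  by rewrite dualE_mul_mem ?adjm_mem.
apply/matrixP => y z; rewrite dualE_mulE !mxE !(twin_eq _ schemeP qthin).
have [->|] := eqVneq y y0.
  have [->|] /= := eqVneq z z0; first by rewrite eqxx.
  rewrite [y0 == _]eq_sym (negPf yy) /=.
  by have [->|] := eqVneq z (twin z0); rewrite //= [_ == r y0 z0]eq_sym yz.
have [->|] //= := eqVneq y (twin y0).
have [->|] /= := eqVneq z z0.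
  by rewrite rel_twinl // [_ == r y0 z0]eq_sym yz [z0 == _]eq_sym (negPf zz).
by have [->|] := eqVneq z (twin z0); rewrite //= rel_twin2 // eqxx.
Qed.

Lemma pairing_mul y w z : twin y != y -> twin w != w -> twin z != z ->
  pairing y w * pairing w z = pairing y z.
Proof.
move=> yy ww zz; apply/matrixP => u v; rewrite !mxE (bigD1 w) // (bigD1 (twin w)) //=.
rewrite big1 ?addr0 => [|e /andP[/negPf ew /negPf ew']]; last first.
  by rewrite !mxE ew ew' !andbF mul0r.
rewrite !mxE !eqxx ![w == twin w]eq_sym (negPf ww) /= !andbT !andbF !orbF /=.
have [->|] := eqVneq u y; first by rewrite [y == _]eq_sym (negPf yy) /= mul0r addr0 mul1r orbF.
by have [->|] //= := eqVneq u (twin y); rewrite mul0r add0r ?mul1r ?mul0r.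
Qed.

(** Permutation blocks multiply along a path of [adj]. Each edge provides both matchings, so any
    point of an intermediate fibre, here [rep a], may be used. *)
Lemma conn_pairing_mem y z : conn (c y) (c z) -> pairing y z \in T.
Proof.
case/and3P => A2y A2z /connectP[p]; elim: p y A2y => [|a p IHp] y A2y /=.
  by move=> _ zE; apply: adj_pairing_mem; rewrite zE adj_refl.
case/andP => ya ap zE; have /and3P[_ A2a _] := ya.
have yy : twin y != y by rewrite -(Aset2E x schemeP qthin).
rewrite -(@pairing_mul y (rep a) z) -?(Aset2E x schemeP qthin) ?c_rep //.
by apply: memvM; [apply: adj_pairing_mem | apply: IHp]; rewrite c_rep.
Qed.

(** Blockwise, a twinned matrix is a multiple of the all-ones block when the fibres are not
    connected, and a combination of the two permutation blocks when they are. *)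
Lemma twinned_Terwilliger : (twinned <= T)%VS.
Proof.
apply/subvP => M TM; have [M1 M2] := twinnedP _ TM.
have -> : M = \sum_a \sum_b dualE F r x a * M * dualE F r x b.
  apply/matrixP => y z; rewrite summxE (bigD1 (c y)) //= [X in _ + X]big1 ?addr0 => [|a ya].
    rewrite summxE (bigD1 (c z)) //= big1 ?addr0 => [|b zb]; rewrite dualE_mulE.
      by rewrite !eqxx.
    by rewrite [c z == b]eq_sym (negPf zb) andbF.
  by rewrite summxE big1 // => b _; rewrite dualE_mulE eq_sym (negPf ya).
apply: memv_suml => a _; apply: memv_suml => b _.
have [ab|nab] := boolP (conn a b); last first.
  rewrite (_ : _ * _ = M (rep a) (rep b) *: \matrix_(y, z) ((c y == a) && (c z == b))%:R).
    by rewrite memvZ ?block_const_mem.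
  apply/matrixP => y z; rewrite dualE_mulE !mxE; case: ifP => [|_]; last by rewrite mulr0.
  rewrite mulr1 -{1}(c_rep a) -{1}(c_rep b) !(twin_eq _ schemeP qthin).
  have M3 : M (rep a) (twin (rep b)) = M (rep a) (rep b) by rewrite M2 ?c_rep.
  by case/andP => /orP[]/eqP-> /orP[]/eqP->; rewrite ?M1 ?twinned_shift.
rewrite (_ : _ * _ = M (rep a) (rep b) *: pairing (rep a) (rep b)
   + M (rep a) (twin (rep b)) *: pairing (rep a) (twin (rep b))).
  by rewrite memvD ?memvZ ?conn_pairing_mem ?c_twin ?c_rep.
have /and3P[A2a A2b _] := ab.
have aa : twin (rep a) != rep a by rewrite -(Aset2E x schemeP qthin) ?c_rep.
have bb : twin (rep b) != rep b by rewrite -(Aset2E x schemeP qthin) ?c_rep.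
apply/matrixP => y z; rewrite dualE_mulE !mxE -{1}(c_rep a) -{1}(c_rep b).
rewrite !(twin_eq _ schemeP qthin) twK.
have [->|] := eqVneq y (rep a).
  rewrite [rep a == _]eq_sym (negPf aa) /= !orbF; have [->|] := eqVneq z (rep b).
    by rewrite [rep b == _]eq_sym (negPf bb) mulr1 mulr0 addr0.
  by have [->|] /= := eqVneq z (twin (rep b)); rewrite ?mulr1 ?mulr0 ?add0r.
have [->|] /= := eqVneq y (twin (rep a)); last by rewrite !mulr0 addr0.
have [->|] := eqVneq z (rep b).
  by rewrite [rep b == _]eq_sym (negPf bb) mulr1 mulr0 add0r twinned_shift.
by have [->|] /= := eqVneq z (twin (rep b)); rewrite ?mulr1 ?mulr0 ?addr0 ?M1.
Qed.

Lemma TerwilligerE : (T : {vspace 'M[F]_N.+1}) = twinned.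
Proof.
by apply/eqP; rewrite eqEsubv Terwilliger_twinned twinned_Terwilliger.
Qed.

End Twinned.

Section Extension.
Variables (F : fieldType) (I : finType) (C : {set I}) (A : 'M[F]_#|C|).

(* Reads [A] through the enumeration of [C], with value 0 off C * C. *)
Definition ext_mx (a b : I) : F :=
  \sum_i \sum_j A i j *+ ((enum_val i == a) && (enum_val j == b)).

Lemma ext_mxE i j : ext_mx (enum_val i) (enum_val j) = A i j.
Proof.
rewrite /ext_mx (bigD1 i) //= (bigD1 j) //= !eqxx.
rewrite big1 ?addr0 => [|j' /negPf jj]; last by rewrite (inj_eq enum_val_inj) jj andbF.
rewrite big1 ?addr0 // => i' /negPf ii.
by rewrite big1 // => j' _; rewrite (inj_eq enum_val_inj) ii.
Qed.

Lemma ext_mx0 a b : ~~ ((a \in C) && (b \in C)) -> ext_mx a b = 0.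
Proof.
move=> nab; apply: big1 => i _; apply: big1 => j _; case: andP => [[/eqP ia /eqP jb]|] //.
by rewrite -ia -jb !enum_valP in nab.
Qed.

End Extension.

(** * The matrix representations and their joint kernel *)

Section QuotientMatrices.
Variables (F : fieldType) (N d : nat).
Variables (r : 'I_N.+1 -> 'I_N.+1 -> 'I_d.+1) (x : 'I_N.+1).

Local Notation twin := (twin r x).
Local Notation rep := (rep r x).
Local Notation conn := (conn r).
Local Notation c := (r x).
Local Notation twinned := (twinned F r x).

(** For twinned [M], the action on functions constant on fibres, in the basis of fibre indicators
    indexed by [B]. *)
Definition quot_mx (B : {set 'I_d.+1}) (M : 'M[F]_N.+1) : 'M[F]_#|B| :=
  \matrix_(i, j) \sum_(z | c z == enum_val j) M (rep (enum_val i)) z.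

(** For twinned [M] and a class [C], the action on antisymmetric functions, in the basis of
    differences of the indicators of [rep b] and [twin (rep b)]. *)
Definition skew_mx (C : {set 'I_d.+1}) (M : 'M[F]_N.+1) : 'M[F]_#|C| :=
  \matrix_(i, j) (M (rep (enum_val i)) (rep (enum_val j))
                  - M (rep (enum_val i)) (twin (rep (enum_val j)))).

Lemma quot_mx_linear B : linear (quot_mx B).
Proof.
move=> a A A'; apply/matrixP => i j; rewrite !mxE mulr_sumr -big_split /=.
by apply: eq_bigr => z _; rewrite !mxE.
Qed.

Lemma skew_mx_linear C : linear (skew_mx C).
Proof.
move=> a A A'; apply/matrixP => i j; rewrite !mxE.
by rewrite opprD addrACA -mulrBr.
Qed.

HB.instance Definition _ (B : {set 'I_d.+1}) :=
  GRing.isLinear.Build F 'M[F]_N.+1 'M[F]_#|B| _ (quot_mx B) (quot_mx_linear B).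
HB.instance Definition _ (C : {set 'I_d.+1}) :=
  GRing.isLinear.Build F 'M[F]_N.+1 'M[F]_#|C| _ (skew_mx C) (skew_mx_linear C).

Hypotheses (schemeP : is_scheme r) (qthin : quasi_thin r).

Let twK := twinK x schemeP qthin.
Let c_twin y : c (twin y) = c y := rel_twin r x y.
Let c_rep a : c (rep a) = a := rel_rep x schemeP a.

Lemma rep_twin y : y = rep (c y) \/ y = twin (rep (c y)).
Proof. by apply: (fibreP schemeP qthin); rewrite c_rep. Qed.

Lemma sum_fibre_const (h : 'I_N.+1 -> F) b : (forall z, h (twin z) = h z) ->
  \sum_(z | c z == b) h z = (valency r b)%:R * h (rep b).
Proof.
move=> hE; rewrite (eq_bigr (fun=> h (rep b))) => [|z /eqP <-].
  rewrite sumr_const (valencyE x schemeP) mulr_natl.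
  by congr (_ *+ _); apply: eq_card => z; rewrite inE.
by case: (rep_twin z) => {1}->; rewrite ?hE.
Qed.

Lemma sum_fibre2 (h : 'I_N.+1 -> F) b : b \in Aset r 2 ->
  \sum_(z | c z == b) h z = h (rep b) + h (twin (rep b)).
Proof.
rewrite -{1}(c_rep b) Aset2E // => bb; rewrite (bigD1 (rep b)) ?c_rep //=.
rewrite (bigD1 (twin (rep b))) ?c_twin ?c_rep ?eqxx ?bb //= big1 ?addr0 //.
move=> z /andP[/andP[/eqP cz]]; have := rep_twin z; rewrite cz.
by case=> -> ; rewrite eqxx.
Qed.

Lemma sum_fibres (h : 'I_N.+1 -> F) : \sum_z h z = \sum_b \sum_(z | c z == b) h z.
Proof. exact: (partition_big c predT). Qed.

(* All of S if 2 is invertible in F, the relations of valency 1 otherwise: with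
   this choice of indices both characteristics are treated at once. *)
Definition units : {set 'I_d.+1} := [set a | (valency r a)%:R != 0 :> F].

Lemma valency12 a : (a \in Aset r 1) || (a \in Aset r 2).
Proof. by rewrite -(c_rep a) Aset1E // Aset2E // orbN. Qed.

Lemma units_odd : 2%N \notin [pchar F] -> units = setT.
Proof.
move=> p2; apply/setP => a; rewrite !inE; have := valency12 a; rewrite !inE.
by case/orP => /eqP->; rewrite ?oner_eq0 //; move: p2; rewrite inE /=.
Qed.

Lemma units_even : 2%N \in [pchar F] -> units = Aset r 1.
Proof.
move=> p2; apply/setP => a; have := valency12 a; rewrite !inE.
by case/orP => /eqP->; rewrite ?oner_eq0 ?(pcharf0 p2) ?eqxx.
Qed.

(** A non-unit exists only if 2 vanishes in [F], and then all units have valency 1. *)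
Lemma units_nunits a b : a \in units -> b \notin units ->
  twin (rep a) = rep a.
Proof.
move=> Ba Bb; apply/eqP; rewrite -Aset1E // c_rep.
have := valency12 a; case/orP => // A2a; move: Bb Ba; rewrite !inE negbK.
have := valency12 b; rewrite !inE => /orP[]/eqP->; rewrite ?oner_eq0 // => p2.
by move: A2a; rewrite inE => /eqP->; rewrite p2.
Qed.

Lemma twinned_rows (M : 'M[F]_N.+1) y b : M \in twinned ->
  \sum_(z | c z == b) M (twin y) z = \sum_(z | c z == b) M y z.
Proof.
move=> TM; have [M1 _] := twinnedP _ _ _ TM.
rewrite (sum_twin (x := x) schemeP qthin) => [|z]; last by rewrite c_twin.
by apply: eq_bigr => z _; rewrite M1.
Qed.

Lemma quot_mxM (A B : 'M[F]_N.+1) : A \in twinned -> B \in twinned ->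
  quot_mx units (A * B) = quot_mx units A *m quot_mx units B.
Proof.
move=> TA TB; apply/matrixP => i j; rewrite !mxE.
set a := enum_val i; set b := enum_val j.
have [A1 _] := twinnedP _ _ _ TA.
under eq_bigr do rewrite mxE.
rewrite exchange_big /= sum_fibres.
transitivity (\sum_e (\sum_(w | c w == e) A (rep a) w) *
                     (\sum_(z | c z == b) B (rep e) z)).
  apply: eq_bigr => e _; rewrite mulr_suml; apply: eq_bigr => w /eqP <-.
  rewrite -mulr_sumr; congr (_ * _); case: (rep_twin w) => {1}-> //.
  by rewrite twinned_rows.
(* For a non-unit [e] the point [rep a] is its own twin, so its row of [A] is constant on the fibre
   of [e] and sums to a multiple of a vanishing valency. *)
rewrite (bigID (mem units)) /= [X in _ + X]big1 ?addr0 => [|e Be]; last first.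
  rewrite sum_fibre_const => [|z].
    by move: Be; rewrite inE negbK => /eqP->; rewrite !mul0r.
  by rewrite -[in LHS](units_nunits (enum_valP i) Be) A1.
by rewrite big_enum_val; apply: eq_bigr => k _; rewrite !mxE.
Qed.

Lemma skew_mxM C (A B : 'M[F]_N.+1) : closed_class r C ->
    A \in twinned -> B \in twinned ->
  skew_mx C (A * B) = skew_mx C A *m skew_mx C B.
Proof.
move=> [_ /subsetP CA2 _ Ccl] TA TB; apply/matrixP => i j; rewrite !mxE.
set a := enum_val i; set b := enum_val j.
have [_ B2] := twinnedP _ _ _ TB.
rewrite -sumrB sum_fibres (bigID (mem C)) /=.
(* Outside [C] the fibre of [e] is not connected to [b], so the two entries of [B] cancel. *)
rewrite [X in _ + X]big1 ?addr0 => [|e Ce]; last first.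
  apply: big1 => w /eqP cw; rewrite B2 ?subrr // c_rep cw.
  apply: contra Ce => eb; apply: (Ccl b); rewrite ?enum_valP //.
  by rewrite (connC x schemeP qthin).
rewrite big_enum_val; apply: eq_bigr => k _; rewrite !mxE.
rewrite sum_fibre2 ?CA2 ?enum_valP // !(twinned_shift schemeP qthin _ _ TB) twK.
by rewrite -!mulrBr mulrBl -[X in _ - _ * X]opprB mulrN opprK.
Qed.

Lemma quot_mx_onto (A : 'M[F]_#|units|) : exists2 M, M \in twinned &
  quot_mx units M = A /\ forall C, skew_mx C M = 0.
Proof.
(* Each entry of [A] is spread evenly over a row of its block; where the valency vanishes in [F], so
   does [ext_mx]. *)
exists (\matrix_(y, z) (ext_mx A (c y) (c z) / (valency r (c z))%:R)).
  by apply/twinnedP; split=> y z; rewrite ?mxE // !c_twin.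
split=> [|C]; apply/matrixP => i j; rewrite !mxE; last by rewrite c_twin subrr.
rewrite (eq_bigr (fun=> A i j / (valency r (enum_val j))%:R)) => [|z /eqP cz].
  rewrite sum_fibre_const // mulrC mulfVK //.
  by have := enum_valP j; rewrite inE.
by rewrite mxE cz c_rep ext_mxE.
Qed.

Lemma skew_mx_onto (C : {set 'I_d.+1}) (A : 'M[F]_#|C|) : closed_class r C -> exists2 M, M \in twinned &
  skew_mx C M = A /\
  forall C', closed_class r C' -> C' != C -> skew_mx C' M = 0.
Proof.
move=> [_ /subsetP CA2 Cconn Ccl].
(* On each block of [C], a multiple of the permutation matching representatives with
   representatives. Its quotient matrix need not vanish; [f_ontoI] corrects for that. *)
pose M : 'M[F]_N.+1 := \matrix_(y, z)
  (ext_mx A (c y) (c z) *+ ((y == rep (c y)) == (z == rep (c z)))).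
have twin_rep y : c y \in C -> (twin y == rep (c y)) = (y != rep (c y)).
  move/CA2; rewrite Aset2E // => yy.
  have [yE|yE] := rep_twin y; first by rewrite -yE eqxx (negPf yy).
  have <- : twin y = rep (c y) by rewrite {1}yE twK.
  by rewrite eqxx eq_sym yy.
exists M; last split.
- apply/twinnedP; split=> y z; rewrite !mxE !c_twin.
    have [/andP[Cy Cz]|nC] := boolP ((c y \in C) && (c z \in C)); last first.
      by rewrite ext_mx0 // !mul0rn.
    by rewrite !twin_rep //; case: (y == _); case: (z == _).
  move=> nc; rewrite ext_mx0 ?mul0rn //.
  by apply: contra nc => /andP[Cy Cz]; apply: Cconn.
- apply/matrixP => i j; rewrite !mxE !c_twin !c_rep ext_mxE !eqxx.
  have := enum_valP j; rewrite -{1}(c_rep (enum_val j)) => /twin_rep.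
  by rewrite c_rep eqxx => ->; rewrite subr0.
move=> C' [_ _ C'conn C'cl] neqC; apply/matrixP => i j; rewrite !mxE !c_twin !c_rep.
rewrite ext_mx0 ?mul0rn ?subrr //; apply: contra neqC => /andP[Ci _].
have C'i := enum_valP i; rewrite eqEsubset; apply/andP; split; apply/subsetP => b Cb.
  by apply: (Ccl (enum_val i)) => //; apply: C'conn.
by apply: (C'cl (enum_val i)) => //; apply: Cconn.
Qed.

Section Kernel.
Variable P : {set {set 'I_d.+1}}.
Hypothesis Pclasses : is_classes (Aset r 2) (sim r) P.

Definition in_kernel M := [/\ M \in twinned, quot_mx units M = 0 &
  forall C, C \in P -> skew_mx C M = 0].

Lemma kernel_twin M : in_kernel M -> forall y z, M y (twin z) = M y z.
Proof.
case=> TM _ skew0 y z; have [M1 M2] := twinnedP _ _ _ TM.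
have [yz|/M2 //] := boolP (conn (c y) (c z)); have /and3P[A2y _ _] := yz.
have [C PC CE] := class_exists x schemeP qthin Pclasses A2y.
have Cy : c y \in C by rewrite CE (conn_refl A2y).
have Cz : c z \in C by rewrite CE.
have E : M (rep (c y)) (twin (rep (c z))) = M (rep (c y)) (rep (c z)).
  move/matrixP/(_ (enum_rank_in Cy (c y)) (enum_rank_in Cz (c z))): (skew0 C PC).
  by rewrite !mxE !enum_rankK_in // => /eqP; rewrite subr_eq0 => /eqP.
by case: (rep_twin y) => ->; case: (rep_twin z) => ->;
  rewrite ?c_twin ?c_rep ?(twinned_shift schemeP qthin _ _ TM) ?twK ?E.
Qed.

(** Blocks of [M] are constant by [kernel_twin], so an entry of the quotient matrix is an invertible
    valency times an entry of [M]. *)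
Lemma kernel_units M y z : in_kernel M -> c y \in units -> c z \in units -> M y z = 0.
Proof.
move=> KM By Bz; have Mtw := kernel_twin KM; case: KM => TM quot0 _.
have : M (rep (c y)) (rep (c z)) = 0.
  move/matrixP/(_ (enum_rank_in By (c y)) (enum_rank_in Bz (c z))): quot0.
  rewrite !mxE !enum_rankK_in // sum_fibre_const => [/eqP|w]; last exact: Mtw.
  by rewrite mulf_eq0; move: Bz; rewrite inE => /negPf-> /eqP.
move=> E; case: (rep_twin y) => ->; case: (rep_twin z) => ->;
  by rewrite ?c_twin ?c_rep ?(twinned_shift schemeP qthin _ _ TM) ?twK ?Mtw ?E.
Qed.

Lemma kernel_odd M : 2%N \notin [pchar F] -> in_kernel M -> M = 0.
Proof.
move=> p2 KM; apply/matrixP => y z; rewrite mxE.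
by apply: kernel_units => //; rewrite units_odd // inE.
Qed.

(* The other fibres contribute a multiple of a valency that vanishes in F. *)
Lemma sum_units (h : 'I_N.+1 -> F) : (forall z, h (twin z) = h z) ->
  (forall z, c z \in units -> h z = 0) -> \sum_z h z = 0.
Proof.
move=> htw h0; rewrite sum_fibres big1 // => b _; have [Bb|] := boolP (b \in units).
  by apply: big1 => z /eqP zb; rewrite h0 // zb.
by rewrite sum_fibre_const // inE negbK => /eqP->; rewrite mul0r.
Qed.

(** Sums over middle points see only unit fibres. So the columns of [M * M] over units vanish, since
    the unit-by-unit part of [M] does, and one more factor kills the rest. *)
Lemma kernel_cube M : in_kernel M -> M ^+ 3 = 0.
Proof.
move=> KM; have Mtw := kernel_twin KM; have [TM _ _] := KM.
have Mtw' y z : M (twin y) z = M y z by rewrite (twinned_shift schemeP qthin).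
have M2 y w : c w \in units -> (M * M) y w = 0.
  move=> Bw; rewrite mxE; apply: sum_units => z; first by rewrite Mtw Mtw'.
  by move=> Bz; rewrite (kernel_units KM Bz Bw) mulr0.
rewrite !exprS expr0 mulr1 mulrA; apply/matrixP => y w; rewrite mxE [RHS]mxE.
apply: sum_units => z; last by move=> Bz; rewrite M2 ?mul0r.
rewrite Mtw' ; congr (_ * _); rewrite !mxE.
by apply: eq_bigr => e _; rewrite Mtw.
Qed.

End Kernel.
End QuotientMatrices.

(** * Application to the Terwilliger algebra *)

Section TerwilligerBlocks.
Variables (F : fieldType) (N d : nat).
Variables (r : 'I_N.+1 -> 'I_N.+1 -> 'I_d.+1) (x : 'I_N.+1).
Hypotheses (schemeP : is_scheme r) (qthin : quasi_thin r).

Local Notation T := (subvs_of (Terwilliger F r x)).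

Definition quot_hom : 'Hom(T, 'M[F]_#|units F r|) :=
  linfun (quot_mx r x (units F r) \o vsval).

Definition skew_hom C : 'Hom(T, 'M[F]_#|C : {set 'I_d.+1}|) :=
  linfun (skew_mx r x C \o vsval).

Lemma quot_homE t : quot_hom t = quot_mx r x (units F r) (vsval t).
Proof. by rewrite lfunE. Qed.

Lemma skew_homE C t : skew_hom C t = skew_mx r x C (vsval t).
Proof. by rewrite lfunE. Qed.

Lemma vsval_twinned (t : T) : vsval t \in twinned F r x.
Proof. by rewrite -TerwilligerE // subvsP. Qed.

Lemma vsval_onto M : M \in twinned F r x -> exists t : T, vsval t = M.
Proof. by rewrite -TerwilligerE // => TM; exists (Subvs TM). Qed.

Lemma quot_homM u v : quot_hom (u * v) = quot_hom u *m quot_hom v.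
Proof. by rewrite !quot_homE -quot_mxM //; apply: vsval_twinned. Qed.

Lemma skew_homM C : closed_class r C -> forall u v,
  skew_hom C (u * v) = skew_hom C u *m skew_hom C v.
Proof.
by move=> Ccl u v; rewrite !skew_homE -skew_mxM //; apply: vsval_twinned.
Qed.

Lemma quot_hom_onto A : exists2 u, quot_hom u = A & forall C, skew_hom C u = 0.
Proof.
have [M /vsval_onto[t <-] [MA M0]] := quot_mx_onto x schemeP qthin A.
by exists t => [|C]; rewrite ?quot_homE ?skew_homE // M0.
Qed.

Lemma skew_hom_onto C A : closed_class r C -> exists2 u, skew_hom C u = A &
  forall C', closed_class r C' -> C' != C -> skew_hom C' u = 0.
Proof.
move=> Ccl; have [M /vsval_onto[t <-] [MA M0]] := skew_mx_onto x schemeP qthin A Ccl.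
by exists t => [|C' C'cl neqC]; rewrite skew_homE // M0.
Qed.

(** The diagonal relation has valency 1, hence is a unit in every characteristic. *)
Lemma card_units_gt0 : (0 < #|units F r|)%N.
Proof.
have : r x x \in Aset r 1.
  rewrite Aset1E //; have : r x (twin r x x) = r x x by apply: rel_twin.
  by rewrite (rel_diag schemeP) => /eqP; case: schemeP => _ [-> _]; rewrite eq_sym.
rewrite inE => /eqP val1; apply/card_gt0P; exists (r x x).
by rewrite inE val1 oner_eq0.
Qed.

Variable P : {set {set 'I_d.+1}}.
Hypothesis Pclasses : is_classes (Aset r 2) (sim r) P.

Let Pclass C (PC : C \in P) := classP x schemeP qthin Pclasses PC.

Lemma kernelP (t : T) : in_kernel r x P (vsval t) <->
  quot_hom t = 0 /\ forall C, C \in P -> skew_hom C t = 0.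
Proof.
split=> [[_ t0 t1]|[]]; rewrite quot_homE.
  by split=> // C PC; rewrite skew_homE t1.
move=> t0 t1; split=> // [|C PC]; first exact: vsval_twinned.
by rewrite -skew_homE t1.
Qed.

(** Each map is onto a full matrix algebra, so its kernel contains the radical; conversely the joint
    kernel absorbs left multiplication and its elements have zero cube. *)
Lemma jacobsonP (t : T) : in_jacobson t <->
  quot_hom t = 0 /\ forall C, C \in P -> skew_hom C t = 0.
Proof.
split=> [Jt|[t0 t1]].
  split=> [|C PC]; apply: in_jacobson_mx_kernel Jt.
  - exact: quot_homM.
  - by move=> A; have [u <- _] := quot_hom_onto A; exists u.
  - exact: skew_homM (Pclass PC).
  - by move=> A; have [u <- _] := skew_hom_onto A (Pclass PC); exists u.
apply: nil_in_jacobson => a; apply: val_inj.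
apply: (kernel_cube schemeP qthin Pclasses (M := vsval (a * t))); apply/kernelP.
split=> [|C PC]; first by rewrite quot_homM t0 mulmx0.
by rewrite (skew_homM (Pclass PC)) t1 ?mulmx0.
Qed.

(** Serves both characteristics: [pi] is the identity when 2 is invertible and the quotient by the
    radical otherwise. *)
Lemma Terwilliger_quotient_blocks (B : falgType F) (pi : 'AHom(T, B)) :
    limg pi = fullv ->
    (forall t, t \in lker pi <->
       quot_hom t = 0 /\ forall C, C \in P -> skew_hom C t = 0) ->
  exists (K0 : {vspace B}) (K : {set 'I_d.+1} -> {vspace B}),
    [/\ [/\ min_ideal K0, has_algid K0, simple_alg K0 & iso_mx K0 #|units F r|],
        forall C, C \in P -> [/\ min_ideal (K C), has_algid (K C) & iso_mx (K C) #|C|],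
        (K0 + \sum_(C in P) K C)%VS = fullv &
        directv (K0 + \sum_(C in P) K C)].
Proof.
move=> pi_onto pi_ker.
apply: (matrix_blocks_quotient card_units_gt0 _ quot_homM _ _ _ pi_onto pi_ker).
- by move=> C /Pclass[].
- by move=> C /Pclass/skew_homM.
- by move=> A; have [u uA u0] := quot_hom_onto A; exists u.
move=> C PC A; have [u uA u0] := skew_hom_onto A (Pclass PC); exists u => // C' PC'.
exact/u0/Pclass.
Qed.

End TerwilligerBlocks.

(** All fibres are singletons, so [twin] is the identity, every matrix is twinned, and the inclusion
    is the isomorphism. *)
Lemma Terwilliger_thin (F : fieldType) (N d : nat)
    (r : 'I_N.+1 -> 'I_N.+1 -> 'I_d.+1) (x : 'I_N.+1) :
    is_scheme r -> thin r ->
  exists f : 'AHom(subvs_of (Terwilliger F r x), 'M[F]_N.+1),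
    lker f = 0%VS /\ limg f = fullv.
Proof.
move=> schemeP thinr; have qthin : quasi_thin r by move=> a; rewrite thinr.
have twinE y : twin r x y = y by apply/eqP; rewrite -(Aset1E x schemeP) // inE thinr.
have memT M : M \in (Terwilliger F r x : {vspace 'M[F]_N.+1}).
  by rewrite TerwilligerE //; apply/twinnedP; split=> y z *; rewrite !twinE.
pose f := linfun (vsval : subvs_of (Terwilliger F r x) -> 'M[F]_N.+1).
have f_ahom : ahom_in {:_} f.
  apply/ahom_inP; split=> [u v _ _|]; first by rewrite !lfunE.
  by rewrite lfunE /=; apply/eqP; rewrite algid_eq1 memT.
exists (AHom f_ahom); split; apply/eqP.
  rewrite -subv0; apply/subvP => u; rewrite memv_ker memv0 lfunE /= => /eqP u0.
  by apply/eqP/val_inj.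
rewrite eqEsubv subvf; apply/subvP => M _; apply/memv_imgP.
by exists (Subvs (memT M)); rewrite ?memvf // lfunE.
Qed.

Theorem theoremE (F : fieldType) (N d : nat)
  (r : 'I_N.+1 -> 'I_N.+1 -> 'I_d.+1) (x : 'I_N.+1) :
  is_scheme r -> quasi_thin r ->
  (* (i) *)
  (thin r ->
     exists f : 'AHom(subvs_of (Terwilliger F r x), 'M[F]_N.+1),
       lker f = 0%VS /\ limg f = fullv) /\
  (* (ii) *)
  (~ thin r ->
     equiv_on (Aset r 2) (sim r) /\
     forall P : {set {set 'I_d.+1}}, is_classes (Aset r 2) (sim r) P ->
     (* (a) *)
     (2 \notin [pchar F] ->
        exists (I1 : {vspace subvs_of (Terwilliger F r x)})
               (I : {set 'I_d.+1} -> {vspace subvs_of (Terwilliger F r x)}),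
          [/\ min_ideal I1, forall C, C \in P -> min_ideal (I C),
              has_algid I1 /\ (forall C, C \in P -> has_algid (I C)),
              simple_alg I1 /\ \dim I1 = (d.+1 ^ 2)%N &
              [/\ (I1 + \sum_(C in P) I C)%VS = fullv,
                  directv (I1 + \sum_(C in P) I C) &
                  forall C, C \in P -> iso_mx (I C) #|C| ]]) /\
     (* (b) *)
     (2 \in [pchar F] ->
        forall (B : falgType F) (pi : 'AHom(subvs_of (Terwilliger F r x), B)),
          limg pi = fullv ->
          (forall t, t \in lker pi <-> in_jacobson t) ->
          exists (K1 : {vspace B}) (K : {set 'I_d.+1} -> {vspace B}),
            [/\ min_ideal K1, forall C, C \in P -> min_ideal (K C),
                has_algid K1 /\ (forall C, C \in P -> has_algid (K C)),
                (K1 + \sum_(C in P) K C)%VS = fullv /\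
                directv (K1 + \sum_(C in P) K C) &
                iso_mx K1 #|Aset r 1| /\
                forall C, C \in P -> iso_mx (K C) #|C| ])).
Proof.
move=> schemeP qthin; split=> [|_]; first exact: Terwilliger_thin.
split=> [|P Pclasses]; first exact: (sim_equiv x).
split=> [p2|p2 B pi pi_onto pi_ker].
  (* When 2 is invertible, [kernel_odd] makes the joint kernel zero, which is the kernel of the
     identity. *)
  have ker_id t : t \in lker (\1%AF : 'AEnd(subvs_of (Terwilliger F r x))) <->
      quot_hom F r x t = 0 /\ forall C, C \in P -> skew_hom F r x C t = 0.
    rewrite memv_ker id_lfunE; split=> [/eqP->|/kernelP K_t].
      by rewrite linear0; split=> // C _; rewrite linear0.
    by apply/eqP/val_inj/(kernel_odd schemeP qthin Pclasses p2)/K_t.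
  have [|I1 [I [[minI1 algI1 simpleI1 isoI1] IP Isum Idir]]] :=
      Terwilliger_quotient_blocks schemeP qthin Pclasses _ ker_id.
    by apply/vspaceP => u; rewrite memvf; apply/memv_imgP; exists u; rewrite ?memvf ?id_lfunE.
  exists I1, I; split=> //.
  - by move=> C /IP[].
  - by split=> // C /IP[].
  - split=> //; rewrite (dim_iso_mx isoI1) units_odd //.
    by rewrite cardsT card_ord.
  - by split=> // C /IP[].
have [|K1 [K [[minK1 algK1 _ isoK1] KP Ksum Kdir]]] :=
    Terwilliger_quotient_blocks schemeP qthin Pclasses pi_onto.
  by move=> t; apply: iff_trans (pi_ker t) (jacobsonP schemeP qthin Pclasses t).
exists K1, K; split=> //.
- by move=> C /KP[].
- by split=> // C /KP[].
- by split=> [|C /KP[]//]; rewrite -(units_even x schemeP qthin p2).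
Qed.
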